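(* Let $I\subseteq\{1,\dots,n\}^2$ be a strict pattern of size $n(n-1)/2$ with complexity $\nu(I)=1$. Let $\{i,j\}$ (resp. $\{k,l\}$) be the unique $2$-element subset of $\{1,\dots,n\}$ such that $(i,j),(j,i)\in I$ (resp. $(k,l),(l,k)\notin I$). (a) If $i,j,k,l$ are not distinct, then $$I\sim\left(\mathrm{NE}_n\setminus\{(1,2)\}\right)\cup\{(3,1)\},\qquad n\ge3,$$ and $\langle\chi_I,\chi_n\rangle=\pm\, n!/2$. (b) If $i,j,k,l$ are distinct, then $I$ is $n$-singular and $$I\sim\left(\mathrm{NE}_n\setminus\{(1,2)\}\right)\cup\{(4,3)\},\qquad n\ge4.$$
   Context: A pattern is a finite set of positions, i.e. of ordered pairs of positive integers; it is strict if it contains no position $(i,i)$. $\mathrm{NE}_n=\{(i,j):1\le i<j\le n\}$. For a pattern $I$, $I^T=\{(j,i):(i,j)\in I\}$, and the complexity $\nu(I)$ is the number of positions $(i,j)\in I\cap I^T$ with $i\le j$. The symmetric group $S_n$ acts on patterns contained in $\{1,\dots,n\}^2$ by $\sigma(I)=\{(\sigma(i),\sigma(j)):(i,j)\in I\}$. A flip is the replacement of a position $(i,j)\in I$ such that $(j,i)\notin I$ by the position $(j,i)$. Two patterns $I,I'\subseteq\{1,\dots,n\}^2$ are weakly equivalent, written $I\sim I'$, if $I$ can be transformed into $I'$ by using flips and the action of $S_n$. For a pattern $I$ put $\chi_I=\prod_{(i,j)\in I}(x_i-x_j)$, and $\chi_n=\chi_{\mathrm{NE}_n}$. $\langle\cdot,\cdot\rangle$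 is the inner product on $\mathbf{R}[x_1,x_2,\dots]$ for which the monomials form an orthonormal basis. A pattern $I\subseteq\{1,\dots,n\}^2$ is $n$-singular if $\chi_I$ belongs to the ideal of $\mathbf{R}[x_1,\dots,x_n]$ generated by the elementary symmetric functions of $x_1,\dots,x_n$ of degrees $1,\dots,n$. *)

(* Defs.v *)
From mathcomp Require Import all_boot all_order all_fingroup all_algebra.
From mathcomp Require Import reals.
From mathcomp Require Import mpoly.

Set Implicit Arguments.
Unset Strict Implicit.
Unset Printing Implicit Defensive.

Import GRing.Theory.
Local Open Scope ring_scope.

(* A pattern contained in {1, ..., n}^2. The index i of the mathematical text
   is the ordinal of value i - 1. *)
Notation pattern n := {set 'I_n * 'I_n}.

(* The singleton {(a, b)}, where a and b are counted from 1; it is empty when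
   (a, b) is not in {1, ..., n}^2. *)
Definition pos1 (n a b : nat) : pattern n :=
  [set p : 'I_n * 'I_n | (p.1.+1 == a :> nat) && (p.2.+1 == b :> nat)].

Definition strict n (I : pattern n) := [forall i, (i, i) \notin I].

Definition NE n : pattern n := [set p : 'I_n * 'I_n | (p.1 < p.2)%N].

Definition swap n (p : 'I_n * 'I_n) : 'I_n * 'I_n := (p.2, p.1).

Definition transpose n (I : pattern n) : pattern n := [set swap p | p in I].

Definition complexity n (I : pattern n) : nat :=
  #|[set p in I :&: transpose I | (p.1 <= p.2)%N]|.

Definition perm_pattern n (s : 'S_n) (I : pattern n) : pattern n :=
  [set (s p.1, s p.2) | p in I].

Definition is_flip n (I J : pattern n) : bool :=
  [exists p in I, (swap p \notin I) && (J == swap p |: (I :\ p))].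

Definition weak_step n : rel (pattern n) :=
  fun I J => is_flip I J || [exists s : 'S_n, J == perm_pattern s I].

Definition weakly_equivalent n : rel (pattern n) := connect (@weak_step n).

Definition double_pair n (I : pattern n) (A : {set 'I_n}) : bool :=
  (#|A| == 2) && [forall a in A, forall b in A, (a != b) ==> ((a, b) \in I)].

Definition missing_pair n (I : pattern n) (A : {set 'I_n}) : bool :=
  (#|A| == 2) && [forall a in A, forall b in A, (a != b) ==> ((a, b) \notin I)].

Definition chi (R : realType) n (I : pattern n) : {mpoly R[n]} :=
  \prod_(p in I) ('X_(p.1) - 'X_(p.2)).

(* The sum over the support of p is the full sum over all monomials. *)
Definition mpoly_dot (R : realType) n (p q : {mpoly R[n]}) : R :=
  \sum_(m <- msupp p) p@_m * q@_m.

Definition in_ideal (A : comNzRingType) (T : finType) (g : T -> A) (p : A) :=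
  exists c : T -> A, p = \sum_(t : T) c t * g t.

Definition singular (R : realType) n (I : pattern n) : Prop :=
  in_ideal (fun k : 'I_n => mesym n R k.+1) (chi R I).

(* Main.v *)
Require Import Defs.
From mathcomp Require Import all_boot all_order all_fingroup all_algebra.
From mathcomp Require Import reals.
From mathcomp Require Import mpoly.
From mathcomp Require Import zify ring lra.

(* Up to flips, I is determined by its doubled pair {i, j} and its missing pair
   {k, l}, so S_n moves it to one of the two normal forms, whose chi is,
   up to sign, J (x_i - x_j) where (x_k - x_l) J is the Vandermonde product V.

   (a) The transposition s of k and l fixes J and negates V, so if j = k then
   <(x_i - x_k) J, V> = <(x_l - x_i) J, V>; the two sides add up to
   -<(x_k - x_l) J, V> = -<V, V> = -n!.

   (b) Let K be the ideal of the elementary symmetric functions and let y be the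
   n - 2 variables other than x_k and x_l. Adding the variables of y one at a
   time to a set s, the elementary symmetric function e_r of the remaining
   variables lies in (s)^r + K. Since each x is a root of the product of the
   t - x_b over the remaining variables b, this gives (y)^N <= K with
   N = n(n-1)/2. Moreover (x_a - x_k)(x_a - x_l) is in (y)^2 + K for a <> k, l,
   whence J (x_i - x_j) is in (y)^N + K = K. *)

Set Implicit Arguments.
Unset Strict Implicit.
Unset Printing Implicit Defensive.

Import GRing.Theory.
Local Open Scope ring_scope.

(** * Powers of ideals generated by some of the variables *)

Record is_ideal (A : comNzRingType) (K : A -> Prop) : Prop := IsIdeal {
  ideal0 : K 0;
  idealD : forall a b, K a -> K b -> K (a + b);
  idealM : forall a b, K b -> K (a * b) }.

(* [ipow K s d] is the ideal (s)^d + K. *)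
Inductive ipow (A : comNzRingType) (K : A -> Prop) (s : seq A) :
    nat -> A -> Prop :=
| IPowT a : ipow K s 0 a
| IPowK d a : K a -> ipow K s d a
| IPowD d a b : ipow K s d a -> ipow K s d b -> ipow K s d (a + b)
| IPowM d x a : x \in s -> ipow K s d a -> ipow K s d.+1 (x * a).

Lemma ideal_sum (A : comNzRingType) (K : A -> Prop) (J : Type) (r : seq J)
    (P : pred J) (F : J -> A) :
  is_ideal K -> (forall i, P i -> K (F i)) -> K (\sum_(i <- r | P i) F i).
Proof. by move=> Ki KF; apply: big_ind => //; case: Ki. Qed.

Lemma in_ideal_is_ideal (A : comNzRingType) (T : finType) (g : T -> A) :
  is_ideal (in_ideal g).
Proof.
split.
- by exists (fun=> 0); rewrite big1 // => t _; rewrite mul0r.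
- move=> _ _ [c ->] [d ->]; exists (fun t => c t + d t).
  by rewrite -big_split; apply: eq_bigr => t _; rewrite mulrDl.
- move=> a _ [c ->]; exists (fun t => a * c t).
  by rewrite mulr_sumr; apply: eq_bigr => t _; rewrite mulrA.
Qed.

Lemma in_ideal_gen (A : comNzRingType) (T : finType) (g : T -> A) (t : T) :
  in_ideal g (g t).
Proof.
exists (fun u => (u == t)%:R); rewrite (bigD1 t) //= eqxx mul1r big1 ?addr0 //.
by move=> u /negPf ->; rewrite mul0r.
Qed.

Lemma ipow_le (A : comNzRingType) (K : A -> Prop) (s : seq A) d e a :
  is_ideal K -> (e <= d)%N -> ipow K s d a -> ipow K s e a.
Proof.
move=> Ki led H; elim: H e led => {d a}.
- by move=> a e; rewrite leqn0 => /eqP ->; apply: IPowT.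
- by move=> d a Ka e _; apply: IPowK.
- by move=> d a b _ IHa _ IHb e le; apply: IPowD; auto.
- move=> d x a xs _ IH [|e] le; first exact: IPowT.
  by apply: IPowM => //; apply: IH.
Qed.

Lemma ipowMl (A : comNzRingType) (K : A -> Prop) (s : seq A) d a b :
  is_ideal K -> ipow K s d b -> ipow K s d (a * b).
Proof.
move=> Ki; elim=> {d b}.
- by move=> b; apply: IPowT.
- by move=> d b Kb; apply: IPowK; apply: idealM.
- by move=> d b c _ IHb _ IHc; rewrite mulrDr; apply: IPowD.
- by move=> d x b xs _ IH; rewrite mulrCA; apply: IPowM.
Qed.

Lemma ipowM (A : comNzRingType) (K : A -> Prop) (s : seq A) d e a b :
  is_ideal K -> ipow K s d a -> ipow K s e b -> ipow K s (d + e) (a * b).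
Proof.
move=> Ki + Hb; elim=> {d a}.
- by move=> a; apply: ipowMl.
- by move=> d a Ka; apply: IPowK; rewrite mulrC; apply: idealM.
- by move=> d a c _ IHa _ IHc; rewrite mulrDl; apply: IPowD.
- by move=> d x a xs _ IH; rewrite addSn -mulrA; apply: IPowM.
Qed.

Lemma ipow_prod (A : comNzRingType) (K : A -> Prop) (s : seq A) (J : Type)
    (r : seq J) (P : pred J) (d : J -> nat) (F : J -> A) :
  is_ideal K -> (forall i, P i -> ipow K s (d i) (F i)) ->
  ipow K s (\sum_(i <- r | P i) d i)%N (\prod_(i <- r | P i) F i).
Proof.
move=> Ki KF; apply: (big_ind2 (fun d a => ipow K s d a)) => //.
  exact: IPowT.
by move=> d1 a1 d2 a2; apply: ipowM.
Qed.

Lemma ipow_sum (A : comNzRingType) (K : A -> Prop) (s : seq A) (J : Type)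
    (r : seq J) (P : pred J) d (F : J -> A) :
  is_ideal K -> (forall i, P i -> ipow K s d (F i)) ->
  ipow K s d (\sum_(i <- r | P i) F i).
Proof.
move=> Ki KF; apply: big_ind => //; last exact: IPowD.
by apply: IPowK; case: Ki.
Qed.

Lemma ipow_mem (A : comNzRingType) (K : A -> Prop) (s : seq A) x :
  x \in s -> ipow K s 1 x.
Proof. by move=> xs; rewrite -(mulr1 x); apply: IPowM => //; apply: IPowT. Qed.

Lemma ipowX (A : comNzRingType) (K : A -> Prop) (s : seq A) x d :
  is_ideal K -> x \in s -> ipow K s d (x ^+ d).
Proof.
move=> Ki xs; elim: d => [|d IH]; first exact: IPowT.
by rewrite exprS; apply: IPowM.
Qed.

Lemma ipow_sub (A : comNzRingType) (K : A -> Prop) (s1 s2 : seq A) d a :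
  {subset s1 <= s2} -> ipow K s1 d a -> ipow K s2 d a.
Proof.
move=> sub; elim=> {d a} *; [exact: IPowT|exact: IPowK|exact: IPowD|].
by apply: IPowM; auto.
Qed.

Definition root_poly (A : comNzRingType) (t : seq A) : {poly A} :=
  \prod_(b <- t) ('X - b%:P).

(* When s and t together are all the variables and K contains their elementary
   symmetric functions, this says e_r(t) \in (s)^r + K. *)
Definition sym_tail (A : comNzRingType) (K : A -> Prop) (s t : seq A) :=
  forall k, ipow K s (size t - k) (root_poly t)`_k.

(** Let p be [root_poly t] and q be [root_poly (x :: t)]. Comparing coefficients in q = (X - x) p
    gives p_k = q_(k+1) + x p_(k+1), and the induction is on the order [size t - k]. *)
Lemma sym_tail_cons (A : comNzRingType) (K : A -> Prop) (s t : seq A) x :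
  is_ideal K -> sym_tail K s (x :: t) -> sym_tail K (x :: s) t.
Proof.
move=> Ki H k; move Em: (size t - k)%N => m.
elim: m k Em => [|m IH] k Em; first exact: IPowT.
have := H k.+1; rewrite /root_poly big_cons -/(root_poly t) /= subSS Em.
rewrite mulrBl coefB coefXM coefCM /= => Hk.
rewrite -(subrK (x * (root_poly t)`_k.+1) (root_poly t)`_k); apply: IPowD.
  by apply: ipow_sub Hk => y ys; rewrite inE ys orbT.
by apply: IPowM; rewrite ?mem_head //; apply: IH; rewrite subnS Em.
Qed.

(** The term of degree d pairs a coefficient of order [size t - d] with x^d, of order d. For t
    consisting of x_k and x_l this places (x_a - x_k)(x_a - x_l) in (y)^2 + K. *)
Lemma sym_tail_horner (A : comNzRingType) (K : A -> Prop) (s t : seq A) x :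
  is_ideal K -> sym_tail K s t -> x \in s ->
  ipow K s (size t) (root_poly t).[x].
Proof.
move=> Ki H xs; rewrite horner_coef; apply: ipow_sum => // k _.
apply: (@ipow_le _ _ _ (size t - k + k)%N) => //; first lia.
by apply: ipowM => //; apply: ipowX.
Qed.

(* As x is a root of [root_poly (x :: t)], its power x^(size t + 1) is a
   combination of lower powers of x with coefficients in powers of (s). *)
Lemma ipow_cons_sub_ideal (A : comNzRingType) (K : A -> Prop) (s t : seq A) x
    D :
  is_ideal K -> sym_tail K s (x :: t) -> (forall z, ipow K s D z -> K z) ->
  forall z, ipow K (x :: s) (D + size t) z -> K z.
Proof.
move=> Ki Ht HD.
(* Strong induction on j. For j at most [size t] the order r is at least D, so w is already in K;
   otherwise the root relation lowers j. *)
have pow_x j r w : ipow K s r w -> (D + size t <= j + r)%N -> K (x ^+ j * w).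
  elim/ltn_ind: j r w => j IH r w Hw le.
  have [ltj|lej] := leqP j (size t).
    apply: idealM => //; apply: HD; apply: ipow_le Hw => //; lia.
  have : (root_poly (x :: t)).[x] = 0.
    by rewrite /root_poly big_cons hornerM hornerXsubC subrr mul0r.
  have szF : size (root_poly (x :: t)) = (size t).+2.
    by rewrite size_prod_XsubC.
  rewrite horner_coef szF big_ord_recr /=.
  have -> : (root_poly (x :: t))`_(size t).+1 = 1.
    have /monicP := monic_prod_XsubC (x :: t) xpredT id.
    by rewrite lead_coefE -/(root_poly (x :: t)) szF.
  rewrite mul1r => /eqP; rewrite addrC addr_eq0 => /eqP xE.
  rewrite -(subnK lej) exprD xE mulrN mulNr -mulN1r; apply: idealM => //.
  rewrite mulr_sumr mulr_suml; apply: ideal_sum => // i _.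
  have -> : x ^+ (j - (size t).+1) * ((root_poly (x :: t))`_i * x ^+ i) * w
     = x ^+ (j - (size t).+1 + i) * ((root_poly (x :: t))`_i * w).
    by rewrite exprD; ring.
  (* The exponent of x drops by [(size t).+1 - i] and the coefficient makes up exactly this order,
     so the total order is unchanged. *)
  apply: (IH _ _ (((size t).+1 - i) + r)%N); last by have := ltn_ord i; lia.
    by have := ltn_ord i; lia.
  by apply: ipowM => //; exact: Ht i.
(* Strengthened for the induction: the factors x peeled off z collect in x^j, those from s in w, and
   the total order stays at least [D + size t]. *)
suff H d z : ipow K (x :: s) d z -> forall j r w, ipow K s r w ->
    (D + size t <= j + r + d)%N -> K (x ^+ j * w * z).
  move=> z /H /(_ 0%N 0%N 1); rewrite expr0 !mul1r; apply; last by [].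
  exact: IPowT.
elim=> {d z}.
- move=> a j r w Hw le; rewrite -mulrA; apply: (pow_x _ r); last lia.
  by rewrite mulrC; apply: ipowMl.
- by move=> d a Ka j r w _ _; apply: idealM.
- by move=> d a b _ IHa _ IHb j r w Hw le; rewrite mulrDr; apply: idealD => //;
    [apply: (IHa _ r)|apply: (IHb _ r)].
- move=> d y a; rewrite inE => /orP[/eqP ->|ys] _ IH j r w Hw le.
    have -> : x ^+ j * w * (x * a) = x ^+ j.+1 * w * a by rewrite exprS; ring.
    by apply: (IH _ r) => //; lia.
  have -> : x ^+ j * w * (y * a) = x ^+ j * (y * w) * a by ring.
  by apply: (IH _ r.+1); [apply: IPowM|lia].
Qed.

(** The variables of u join s one at a time. Each raises the exponent by the number of variables
    still outside s, and these numbers add up to the difference of the two binomials. *)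
Lemma ipow_catrev_sub_ideal (A : comNzRingType) (K : A -> Prop)
    (u s t : seq A) D D' :
  is_ideal K -> sym_tail K s (u ++ t) -> (forall z, ipow K s D z -> K z) ->
  (D' + 'C(size t, 2) = D + 'C(size (u ++ t), 2))%N ->
  sym_tail K (catrev u s) t /\ forall z, ipow K (catrev u s) D' z -> K z.
Proof.
move=> Ki; elim: u s D => [|x u IH] s D Hs HD /=.
  by move=> /eqP; rewrite eqn_add2r => /eqP ->.
rewrite binS bin1 => E; apply: (IH _ (D + size (u ++ t))%N).
- exact: sym_tail_cons.
- exact: ipow_cons_sub_ideal.
- by rewrite E; lia.
Qed.

(** Vieta's formula with the variables themselves as roots; evaluating [mesym] at the variables
    returns [mesym]. *)
Lemma root_poly_mpolyX_coef (R : realType) n (k : 'I_n.+1) :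
  (root_poly [seq ('X_i : {mpoly R[n]}) | i <- enum 'I_n])`_(n - k)
  = (-1) ^+ k * mesym n R k.
Proof.
have -> : root_poly [seq ('X_i : {mpoly R[n]}) | i <- enum 'I_n]
    = \prod_(c <- [tuple ('X_i : {mpoly R[n]}) | i < n]) ('X - c%:P).
  rewrite big_tuple /root_poly big_map big_enum /=.
  by apply: eq_bigr => i _; rewrite tnth_mktuple.
rewrite mroots_coeff; congr (_ * _); rewrite /mesym raddf_sum.
apply: eq_bigr => h _.
rewrite /= rmorph_prod; apply: eq_bigr => i _.
by rewrite /= mevalXU tnth_mktuple.
Qed.

Lemma sym_tail_mesym (R : realType) n :
  sym_tail (in_ideal (fun k : 'I_n => mesym n R k.+1)) [::]
    [seq ('X_i : {mpoly R[n]}) | i <- enum 'I_n].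
Proof.
move=> k; rewrite size_map size_enum_ord.
have [lenk|ltkn] := leqP n k.
  have -> : (n - k = 0)%N by lia.
  exact: IPowT.
have lt1 : (n - k < n.+1)%N by lia.
have := @root_poly_mpolyX_coef R n (Ordinal lt1).
rewrite /= subKn; last exact: ltnW.
move=> ->; apply: IPowK; apply: idealM; first exact: in_ideal_is_ideal.
(* The generator of index i has degree i + 1, so degree n - k has index one less. *)
have lt2 : ((n - k).-1 < n)%N by lia.
have := in_ideal_gen (fun k : 'I_n => mesym n R k.+1) (Ordinal lt2).
by rewrite /= prednK // subn_gt0.
Qed.

(** * Patterns up to flips and permutations *)

(** The quantity that flips preserve: off the diagonal it is 2 on a doubled pair, 0 on a missing one
    and 1 otherwise. *)
Definition mult n (I : pattern n) (a b : 'I_n) : nat :=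
  ((a, b) \in I) + ((b, a) \in I).

Lemma multC n (I : pattern n) a b : mult I a b = mult I b a.
Proof. by rewrite /mult addnC. Qed.

Lemma multxx n (I : pattern n) a : strict I -> mult I a a = 0%N.
Proof. by move=> /forallP /(_ a) /negPf aa; rewrite /mult aa. Qed.

Lemma swapK n : involutive (@swap n).
Proof. by case. Qed.

Lemma in_perm_pattern n (s : 'S_n) (I : pattern n) a b :
  ((s a, s b) \in perm_pattern s I) = ((a, b) \in I).
Proof.
apply/imsetP/idP => [[[c d] cdI [/perm_inj -> /perm_inj ->]] //|abI].
by exists (a, b).
Qed.

Lemma mult_perm n (s : 'S_n) (I : pattern n) a b :
  mult (perm_pattern s I) (s a) (s b) = mult I a b.
Proof. by rewrite /mult !in_perm_pattern. Qed.

Lemma mult_flip n (I : pattern n) p :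
  p \in I -> swap p \notin I ->
  forall a b, mult (swap p |: (I :\ p)) a b = mult I a b.
Proof.
move=> pI spI a b; rewrite /mult -[(b, a)]/(swap (a, b)).
move: {a b}(a, b) => q; rewrite !inE (inj_eq (inv_inj (@swapK n))).
have nsp : (p == swap p) = false.
  by apply/negP => /eqP E; move: spI; rewrite -E pI.
have [->|nqp] := eqVneq q p; first by rewrite nsp pI (negPf spI).
have [->|nqsp] := eqVneq q (swap p).
  by rewrite swapK eqxx pI (negPf spI) andbF.
suff -> : (swap q == p) = false by [].
by rewrite -(inj_eq (inv_inj (@swapK n))) swapK; exact: negPf.
Qed.

(** Induction on the size of I \ J. A position of I outside J has its mirror image in J and not in
    I, so flipping it shrinks I \ J; once I is contained in J, equal multiplicities force
    equality. *)
Lemma connect_flip n (I J : pattern n) :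
  (forall a b, mult I a b = mult J a b) -> connect (@is_flip n) I J.
Proof.
move Em: #|I :\: J| => m; elim: m I Em => [|m IH] I Em EIJ.
  have /eqP := Em; rewrite cards_eq0 setD_eq0 => sIJ.
  suff -> : I = J by exact: connect0.
  apply/eqP; rewrite eqEsubset sIJ; apply/subsetP => -[a b] abJ.
  apply/negPn/negP => abI.
  have := EIJ a b; rewrite /mult abJ (negPf abI).
  by have := subsetP sIJ (b, a); case: (_ \in I) => [/(_ isT) ->|_].
have /card_gt0P[[a b]] : (0 < #|I :\: J|)%N by rewrite Em.
rewrite inE => /andP[abJ abI].
have /andP[baJ baI] : ((b, a) \in J) && ((b, a) \notin I).
  by have := EIJ a b; rewrite /mult abI (negPf abJ); do 2 case: (_ \in _).
pose I' := swap (a, b) |: (I :\ (a, b)).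
have flip : is_flip I I'.
  by apply/existsP; exists (a, b); rewrite abI baI eqxx.
apply: connect_trans (connect1 flip) _; apply: IH => [|c d].
  have : I' :\: J = (I :\: J) :\ (a, b).
    apply/setP => q; rewrite !inE /swap /=.
    by have [->|_] := eqVneq q (b, a); rewrite ?baJ /= ?andbF //= andbCA.
  have abD : (a, b) \in I :\: J by rewrite inE abJ.
  by move=> ->; apply/eqP; rewrite -eqSS -Em [X in _ == X](cardsD1 (a, b)) abD.
by rewrite mult_flip.
Qed.

Lemma chi_flip (R : realType) n (I J : pattern n) :
  is_flip I J -> chi R J = - chi R I.
Proof.
case/existsP => p /and3P[pI spI /eqP ->].
rewrite /chi big_setU1 /=; last by rewrite !inE negb_and spI orbT.
by rewrite (big_setD1 p pI) /= -opprB mulNr.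
Qed.

Lemma chi_connect_flip (R : realType) n (I J : pattern n) :
  connect (@is_flip n) I J -> chi R J = chi R I \/ chi R J = - chi R I.
Proof.
case/connectP => p; elim: p I => [|K p IH] I /= => [_ ->|]; first by left.
case/andP => /(chi_flip R) E pK /(IH _ pK); rewrite E opprK.
by case; [right|left].
Qed.

Lemma connect_flip_weakly_equivalent n (I J : pattern n) :
  connect (@is_flip n) I J -> weakly_equivalent I J.
Proof.
by apply: connect_sub => {}I {}J IJ; apply: connect1; rewrite /weak_step IJ.
Qed.

Lemma chi_perm (R : realType) n (s : 'S_n) (I : pattern n) :
  chi R (perm_pattern s I) = msym s (chi R I).
Proof.
rewrite /chi /perm_pattern big_imset /=; last first.
  by move=> [a b] [c d] _ _ [/perm_inj -> /perm_inj ->].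
rewrite rmorph_prod /=; apply: eq_bigr => p _.
by rewrite msymB /msym !mmapX !mmap1U.
Qed.

(** The transposition of f x and y corrects the head of the list. It fixes the values already
    reached, since f is injective and y does not recur in t. *)
Lemma exists_perm_map (T : finType) (s t : seq T) :
  uniq s -> uniq t -> size s = size t ->
  exists f : {perm T}, map f s = t.
Proof.
elim: s t => [|x s IH] [|y t] //=; first by exists 1%g.
case/andP => xs us /andP[yt ut] [/(IH _ us ut)[f E]].
exists (f * tperm (f x) y)%g; rewrite permM tpermL; congr (_ :: _).
rewrite -E -eq_in_map => z zs; rewrite permM tpermD //.
  by apply: contraNneq xs => /perm_inj ->.
by apply: contraNneq yt => ->; rewrite -E map_f.
Qed.

Lemma eq_set2 (T : finType) (a b c d : T) : a != b ->
  ([set a; b] == [set c; d]) = (a == c) && (b == d) || (a == d) && (b == c).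
Proof.
move=> nab; apply/eqP/orP => [E|[] /andP[/eqP -> /eqP ->] //]; last first.
  by rewrite setUC.
have : a \in [set c; d] by rewrite -E !inE eqxx.
have : b \in [set c; d] by rewrite -E !inE eqxx orbT.
rewrite !inE => /orP[] /eqP Eb /orP[] /eqP Ea; move: nab; rewrite Ea Eb eqxx //.
  by move=> _; right; rewrite eqxx.
by move=> _; left; rewrite eqxx.
Qed.

(* {i, j} is the doubled pair and {k, l} the missing one. *)
Definition shape n (I : pattern n) (i j k l : 'I_n) :=
  strict I /\ forall a b, a != b ->
    (mult I a b + ([set a; b] == [set k; l])
     = 1 + ([set a; b] == [set i; j]))%N.

Lemma strict_perm n (s : 'S_n) (I : pattern n) :
  strict I -> strict (perm_pattern s I).
Proof.
by move=> /forallP H; apply/forallP => a; rewrite -(permKV s a) in_perm_pattern.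
Qed.

Lemma shape_perm n (s : 'S_n) (I : pattern n) i j k l :
  shape I i j k l -> shape (perm_pattern s I) (s i) (s j) (s k) (s l).
Proof.
case=> sI H; split=> [|a b]; first exact: strict_perm.
rewrite -(permKV s a) -(permKV s b) mult_perm (inj_eq perm_inj) => nab.
by have := H _ _ nab; rewrite !eq_set2 ?(inj_eq perm_inj) //
  -(inj_eq (@perm_inj _ s^-1)).
Qed.

Lemma shape_connect_flip n (I J : pattern n) i j k l :
  shape I i j k l -> shape J i j k l -> connect (@is_flip n) I J.
Proof.
move=> [sI HI] [sJ HJ]; apply: connect_flip => a b.
have [->|nab] := eqVneq a b; first by rewrite !multxx.
by have := HI _ _ nab; have := HJ _ _ nab; lia.
Qed.

Lemma shape_weakly_equivalent n (I J : pattern n) i j k l (s : 'S_n) :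
  shape I i j k l -> shape J (s i) (s j) (s k) (s l) -> weakly_equivalent I J.
Proof.
move=> HI HJ; apply: (@connect_trans _ _ (perm_pattern s I)).
  apply: connect1; apply/orP; right; apply/existsP; exists s; exact: eqxx.
exact/connect_flip_weakly_equivalent/(shape_connect_flip (shape_perm s HI) HJ).
Qed.

(** * Counting doubled and missing pairs *)

Lemma sum_NE n (F : 'I_n * 'I_n -> nat) :
  (\sum_(p in NE n) F p = \sum_(b < n) \sum_(a < n | a < b) F (a, b))%N.
Proof.
rewrite (exchange_big_dep xpredT) //= pair_big_dep /=.
by apply: eq_big => [[a b]|[a b] _] //; rewrite inE.
Qed.

Lemma card_NE n : #|NE n| = 'C(n, 2).
Proof.
rewrite -sum1_card sum_NE -[RHS]bin2_sum [RHS]big_mkord; apply: eq_bigr => b _.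
have le : (b <= n)%N by exact: ltnW.
by rewrite -(big_ord_widen n (fun=> 1%N) le) sum1_card card_ord.
Qed.

(** Positions below the diagonal are counted through their mirror images; strictness excludes the
    diagonal. *)
Lemma card_strict n (I : pattern n) :
  strict I -> #|I| = (\sum_(p in NE n) mult I p.1 p.2)%N.
Proof.
move=> sI; rewrite /mult big_split /= -sum1_card (bigID (mem (NE n))) /=.
congr (_ + _)%N.
  rewrite -big_mkcondr; apply: eq_bigl => -[a b]; exact: andbC.
rewrite -big_mkcondr (reindex_inj (inv_inj (@swapK n))) /=.
apply: eq_bigl => -[a b]; rewrite !inE /swap /= andbC -leqNgt.
have [ltab|ltba|/val_inj ->] := ltngtP a b; rewrite ?andbT ?andbF //.
by rewrite (negPf (forallP sI b)) andbF.
Qed.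

Definition doubled n (I : pattern n) : pattern n :=
  [set p in NE n | mult I p.1 p.2 == 2].
Definition missing n (I : pattern n) : pattern n :=
  [set p in NE n | mult I p.1 p.2 == 0%N].

Lemma card_doubled n (I : pattern n) : strict I -> #|doubled I| = complexity I.
Proof.
move=> sI; apply: eq_card => -[a b]; rewrite !inE /mult /=.
have -> : ((a, b) \in transpose I) = ((b, a) \in I).
  exact: (mem_imset I (b, a) (inv_inj (@swapK n))).
rewrite [(a <= b)%N]leq_eqVlt.
case: (@eqP _ (val a) (val b)) => [/val_inj ->|_].
  by rewrite ltnn (negPf (forallP sI b)).
by rewrite orFb andbC; case: ((a, b) \in I); case: ((b, a) \in I).
Qed.

(** Each pair satisfies m + [m = 0] = 1 + [m = 2], where m is its [mult]; sum over [NE n]. At size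
    ['C(n, 2)] there are thus as many missing pairs as doubled ones. *)
Lemma card_missing n (I : pattern n) : strict I ->
  (#|I| + #|missing I| = 'C(n, 2) + #|doubled I|)%N.
Proof.
move=> sI; rewrite (card_strict sI) -card_NE -!sum1_card.
rewrite [X in (_ + X)%N](eq_bigl
  (fun p => (p \in NE n) && (mult I p.1 p.2 == 0%N)));
  last by move=> p; rewrite !inE.
rewrite [X in (_ + X)%N = _]big_mkcondr.
rewrite [X in _ = (_ + X)%N](eq_bigl
  (fun p => (p \in NE n) && (mult I p.1 p.2 == 2)));
  last by move=> p; rewrite !inE.
rewrite [X in _ = (_ + X)%N]big_mkcondr -!big_split; apply: eq_bigr => p _ /=.
by rewrite /mult; do 2 case: (_ \in I).
Qed.

Lemma double_pair2 n (I : pattern n) a b :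
  double_pair I [set a; b] = (a != b) && (mult I a b == 2).
Proof.
rewrite /double_pair cards2 eqSS eqb1; have [//|nab] /= := eqVneq a b.
apply/forall_inP/eqP => [H|E c].
  have := forall_inP (H a (set21 _ _)) b (set22 _ _).
  have := forall_inP (H b (set22 _ _)) a (set21 _ _).
  by rewrite nab eq_sym nab /mult /= => -> ->.
have [abI baI] : (a, b) \in I /\ (b, a) \in I.
  by move: E; rewrite /mult; do 2 case: (_ \in I).
by rewrite !inE => /orP[] /eqP ->; apply/forall_inP => d; rewrite !inE
  => /orP[] /eqP ->; rewrite ?eqxx ?abI ?baI ?implybT.
Qed.

Lemma missing_pair2 n (I : pattern n) a b :
  missing_pair I [set a; b] = (a != b) && (mult I a b == 0%N).
Proof.
rewrite /missing_pair cards2 eqSS eqb1; have [//|nab] /= := eqVneq a b.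
apply/forall_inP/eqP => [H|E c].
  have := forall_inP (H a (set21 _ _)) b (set22 _ _).
  have := forall_inP (H b (set22 _ _)) a (set21 _ _).
  by rewrite nab eq_sym nab /mult /= => /negPf -> /negPf ->.
have [abI baI] : (a, b) \notin I /\ (b, a) \notin I.
  by move: E; rewrite /mult; do 2 case: (_ \in I).
by rewrite !inE => /orP[] /eqP ->; apply/forall_inP => d; rewrite !inE
  => /orP[] /eqP ->; rewrite ?eqxx ?abI ?baI ?implybT.
Qed.

(** Serves the doubled pair (m = 2) and the missing pair (m = 0), with f = [mult I]. A pair
    satisfying P, written in increasing order, is a position of the singleton D. *)
Lemma unique_pair n (D : pattern n) (P : pred {set 'I_n}) m
    (f : 'I_n -> 'I_n -> nat) :
  #|D| = 1%N -> D = [set p in NE n | f p.1 p.2 == m] ->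
  (forall a b, f a b = f b a) -> (forall A, P A -> #|A| = 2) ->
  (forall a b, P [set a; b] = (a != b) && (f a b == m)) ->
  exists! A, P A.
Proof.
move=> /eqP/cards1P[[a b] ->] E fC P2 Pset.
have Dab (c d : 'I_n) : (c < d)%N -> (f c d == m) = ((c, d) == (a, b)).
  by move=> lt; have /setP/(_ (c, d)) := E; rewrite !inE /= lt.
have /setP/(_ (a, b)) := E; rewrite !inE eqxx /= => /esym/andP[ltab fab].
exists [set a; b]; split.
  by rewrite Pset fab andbT -val_eqE /= (ltn_eqF ltab).
move=> A PA; have /eqP/cards2P[c [d [ncd EA]]] := P2 A PA.
move: PA; rewrite EA Pset ncd /= => fcd; apply/esym/eqP; rewrite eq_set2 //.
move: ncd; rewrite -val_eqE /= neq_ltn => /orP[] lt.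
  by move: fcd; rewrite Dab // xpair_eqE => ->.
by move: fcd; rewrite fC Dab // xpair_eqE andbC => ->; rewrite orbT.
Qed.

Lemma bin2_half n : 'C(n, 2) = (n * (n - 1) %/ 2)%N.
Proof. by rewrite bin2 subn1 divn2. Qed.

Lemma unique_double_pair n (I : pattern n) :
  strict I -> complexity I = 1%N -> exists! A, double_pair I A.
Proof.
move=> sI c1; apply: (@unique_pair n (doubled I) _ 2 (mult I)) => //.
- by rewrite card_doubled.
- exact: multC.
- by move=> A /andP[/eqP].
- exact: double_pair2.
Qed.

Lemma unique_missing_pair n (I : pattern n) :
  strict I -> #|I| = 'C(n, 2) -> complexity I = 1%N ->
  exists! A, missing_pair I A.
Proof.
move=> sI cI c1; apply: (@unique_pair n (missing I) _ 0%N (mult I)) => //.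
- by have := card_missing sI; rewrite cI card_doubled // c1; lia.
- exact: multC.
- by move=> A /andP[/eqP].
- exact: missing_pair2.
Qed.

(** By uniqueness, being {i, j} means [mult] 2 and being {k, l} means [mult] 0, which leaves a check
    of the three possible values. *)
Lemma shapeP n (I : pattern n) i j k l :
  strict I -> #|I| = 'C(n, 2) -> complexity I = 1%N ->
  double_pair I [set i; j] -> missing_pair I [set k; l] -> shape I i j k l.
Proof.
move=> sI cI c1 dij mkl; split=> // a b nab.
have [A [_ uA]] := unique_double_pair sI c1.
have [B [_ uB]] := unique_missing_pair sI cI c1.
have -> : ([set a; b] == [set i; j]) = (mult I a b == 2).
  apply/eqP/idP => [E|ab2]; first by have := dij; rewrite -E double_pair2 nab.
  by rewrite -(uA _ dij); apply/esym/uA; rewrite double_pair2 nab.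
have -> : ([set a; b] == [set k; l]) = (mult I a b == 0%N).
  apply/eqP/idP => [E|ab2]; first by have := mkl; rewrite -E missing_pair2 nab.
  by rewrite -(uB _ mkl); apply/esym/uB; rewrite missing_pair2 nab.
by rewrite /mult; do 2 case: (_ \in I).
Qed.

(* a and b are counted from 1, as in [pos1]. *)
Lemma shape_target n (i j k l : 'I_n) (a b : nat) :
  val k = 0%N -> val l = 1%N -> (j < i)%N ->
  a = (val i).+1 -> b = (val j).+1 ->
  shape ((NE n :\: pos1 n 1 2) :|: pos1 n a b) i j k l.
Proof.
move=> k0 l1 ltji -> ->; split.
  apply/forallP => c; rewrite !inE ltnn andbF /= !eqSS.
  by apply/negP => /andP[/eqP E /eqP F]; move: ltji; rewrite -E -F ltnn.
move=> c d; rewrite -val_eqE neq_ltn.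
wlog ltcd : c d / (c < d)%N => [W /orP[] lt|_]; first by apply: W; rewrite ?lt.
  by rewrite multC [[set c; d]]setUC; apply: W; rewrite ?lt.
have ncd : c != d by rewrite -val_eqE neq_ltn ltcd.
(* Since c < d and j < i, the pair {c, d} can equal {i, j} only with c = j and d = i. *)
have notij : (c == i) && (d == j) = false.
  apply/negP => /andP[/eqP ci /eqP dj].
  by move: ltcd; rewrite ci dj ltnNge ltnW.
have notlk : (c == l) && (d == k) = false.
  by apply/negP => /andP[_ /eqP dk]; move: ltcd; rewrite dk k0.
rewrite !eq_set2 // notij notlk orbF /= /mult !inE /= !eqSS.
rewrite ltcd ltnNge (ltnW ltcd) /= !andbT andbF /=.
have -> : (nat_of_ord c == 0%N) = (c == k) by rewrite -val_eqE k0.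
have -> : (nat_of_ord d == 1%N) = (d == l) by rewrite -val_eqE l1.
rewrite !val_eqE notij orbF [(d == i) && _]andbC.
by case: (_ && _); case: (_ && _).
Qed.

(** * The inner product *)

(** Lets polynomials with different supports be summed over one common list, as additivity
    requires. *)
Lemma mpoly_dot_supp (R : realType) n (p q : {mpoly R[n]})
    (r : seq 'X_{1..n}) :
  uniq r -> {subset msupp p <= r} -> mpoly_dot p q = \sum_(m <- r) p@_m * q@_m.
Proof.
move=> ur sub; rewrite /mpoly_dot [RHS](bigID (mem (msupp p))) /=.
rewrite [X in _ = _ + X]big1 ?addr0; last first.
  by move=> m; rewrite mcoeff_msupp negbK => /eqP ->; rewrite mul0r.
rewrite -[RHS]big_filter; apply: perm_big; apply: uniq_perm.
- exact: msupp_uniq.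
- exact: filter_uniq.
move=> m; rewrite mem_filter; case: (boolP (m \in msupp p)) => // mp.
by rewrite /= (sub _ mp).
Qed.

Lemma mpoly_dotDl (R : realType) n (p p' q : {mpoly R[n]}) :
  mpoly_dot (p + p') q = mpoly_dot p q + mpoly_dot p' q.
Proof.
pose r := undup (msupp p ++ msupp p' ++ msupp (p + p')).
rewrite !(@mpoly_dot_supp _ _ _ _ r) ?undup_uniq //.
- by rewrite -big_split; apply: eq_bigr => m _ /=; rewrite mcoeffD mulrDl.
all: by move=> m; rewrite mem_undup !mem_cat => ->; rewrite ?orbT.
Qed.

Lemma mpoly_dot0l (R : realType) n (q : {mpoly R[n]}) : mpoly_dot 0 q = 0.
Proof. by rewrite /mpoly_dot msupp0 big_nil. Qed.

Lemma mpoly_dotZl (R : realType) n c (p q : {mpoly R[n]}) :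
  mpoly_dot (c *: p) q = c * mpoly_dot p q.
Proof.
rewrite (@mpoly_dot_supp _ _ _ _ (msupp p)) ?msupp_uniq //; last first.
  exact: msuppZ_le.
by rewrite mulr_sumr; apply: eq_bigr => m _; rewrite mcoeffZ mulrA.
Qed.

Lemma mpoly_dotNl (R : realType) n (p q : {mpoly R[n]}) :
  mpoly_dot (- p) q = - mpoly_dot p q.
Proof. by rewrite -scaleN1r mpoly_dotZl mulN1r. Qed.

Lemma mpoly_dotNr (R : realType) n (p q : {mpoly R[n]}) :
  mpoly_dot p (- q) = - mpoly_dot p q.
Proof.
by rewrite /mpoly_dot -sumrN; apply: eq_bigr => m _; rewrite mcoeffN mulrN.
Qed.

Lemma mpoly_dotXl (R : realType) n m (q : {mpoly R[n]}) :
  mpoly_dot 'X_[m] q = q@_m.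
Proof. by rewrite /mpoly_dot msuppX big_seq1 mcoeffX eqxx mul1r. Qed.

(** Permuting the variables permutes the orthonormal basis of monomials. *)
Lemma mpoly_dot_msym (R : realType) n (s : 'S_n) (p q : {mpoly R[n]}) :
  mpoly_dot (msym s p) (msym s q) = mpoly_dot p q.
Proof.
pose ms (m : 'X_{1..n}) := [multinom m (s i) | i < n].
pose r := map ms (msupp (msym s p)).
rewrite (@mpoly_dot_supp _ _ p _ r).
- by rewrite big_map; apply: eq_bigr => m _; rewrite !mcoeff_sym.
- rewrite map_inj_uniq ?msupp_uniq // => m m' /mnmP E.
  by apply/mnmP => i; have := E (s^-1%g i); rewrite !mnmE permKV.
move=> m mp; have E : m = ms [multinom m (s^-1%g i) | i < n].
  by apply/mnmP => i; rewrite !mnmE permK.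
by rewrite E; apply: map_f; rewrite mcoeff_msupp mcoeff_sym -/(ms _) -E
  -mcoeff_msupp.
Qed.

(** * The Vandermonde determinant and its norm *)

Definition perm_mnm n (s : 'S_n) : 'X_{1..n} := [multinom (s i : nat) | i < n].

Lemma perm_mnm_inj n : injective (@perm_mnm n).
Proof.
move=> s t /mnmP E; apply/permP => i; apply: val_inj.
by have := E i; rewrite !mnmE.
Qed.

Definition vandermonde_det (R : realType) n : {mpoly R[n]} :=
  \det (Vandermonde n (\row_(i < n) ('X_i : {mpoly R[n]}))).

Lemma vandermonde_detE (R : realType) n :
  vandermonde_det R n = \sum_(s : 'S_n) (-1) ^+ s *: 'X_[perm_mnm s].
Proof.
(* Row i holds the i-th powers, so the Leibniz term of s has exponents given by the inverse of s;
   hence the reindexing by inverses. *)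
rewrite /vandermonde_det /determinant (reindex_inj invg_inj) /=.
apply: eq_bigr => s _; rewrite odd_permV mulr_sign scaler_sign.
suff -> : 'X_[perm_mnm s] = \prod_i Vandermonde n
  (\row_(i < n) ('X_i : {mpoly R[n]})) i (s^-1%g i) by [].
rewrite mpolyXE_id (reindex_perm s^-1) /=.
by apply: eq_bigr => i _; rewrite !mxE mnmE permKV.
Qed.

(** The expansion has n! distinct monomials, each with coefficient 1 or -1. *)
Lemma mpoly_dot_vandermonde_det (R : realType) n :
  mpoly_dot (vandermonde_det R n) (vandermonde_det R n) = n`!%:R.
Proof.
have coef (s : 'S_n) : (vandermonde_det R n)@_(perm_mnm s) = (-1) ^+ s.
  rewrite vandermonde_detE raddf_sum /= (bigD1 s) //= big1 ?addr0.
    by rewrite mcoeffZ mcoeffX eqxx mulr1.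
  by move=> t ts; rewrite mcoeffZ mcoeffX (inj_eq (@perm_mnm_inj n)) (negPf ts)
    mulr0.
rewrite {1}vandermonde_detE.
rewrite (big_morph (fun p => mpoly_dot p _) (fun p p' => mpoly_dotDl p p' _)
  (mpoly_dot0l _)).
under eq_bigr do rewrite mpoly_dotZl mpoly_dotXl coef -expr2 sqrr_sign.
by rewrite sumr_const card_Sn.
Qed.

Lemma chi_NE (R : realType) n :
  chi R (NE n) = vandermonde_det R n \/ chi R (NE n) = - vandermonde_det R n.
Proof.
have -> : vandermonde_det R n = (-1) ^+ #|NE n| * chi R (NE n).
  rewrite /vandermonde_det det_Vandermonde pair_big_dep /= /chi.
  rewrite -prodr_const -big_split /=.
  apply: eq_big => [[a b]|[a b] _]; first by rewrite inE.
  by rewrite !mxE /=; ring.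
rewrite -signr_odd; case: (odd _); last by left; rewrite expr0 mul1r.
by right; rewrite expr1 mulN1r opprK.
Qed.

Lemma mpoly_dot_chi_NE (R : realType) n :
  mpoly_dot (chi R (NE n)) (chi R (NE n)) = n`!%:R.
Proof.
by case: (chi_NE R n) => ->; rewrite ?mpoly_dotNl ?mpoly_dotNr ?opprK;
  exact: mpoly_dot_vandermonde_det.
Qed.

(** A permutation turns [NE n] into another pattern with one position for each pair, which flips
    carry back. *)
Lemma msym_chi_NE (R : realType) n (s : 'S_n) :
  msym s (chi R (NE n)) = chi R (NE n) \/
  msym s (chi R (NE n)) = - chi R (NE n).
Proof.
rewrite -chi_perm; apply: chi_connect_flip; apply: connect_flip => a b.
have multNE c d : mult (NE n) c d = (c != d).
  by rewrite /mult !inE -val_eqE; case: ltngtP.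
by rewrite -(permKV s a) -(permKV s b) mult_perm !multNE (inj_eq perm_inj).
Qed.

(** A flip negates the left argument. A permutation may be applied to both arguments at once, and it
    changes the right one at most by a sign. *)
Lemma mpoly_dot_weakly_equivalent (R : realType) n (I J : pattern n) :
  weakly_equivalent I J ->
  mpoly_dot (chi R I) (chi R (NE n)) = mpoly_dot (chi R J) (chi R (NE n)) \/
  mpoly_dot (chi R I) (chi R (NE n)) = - mpoly_dot (chi R J) (chi R (NE n)).
Proof.
case/connectP => p; elim: p I => [|K p IH] I /= => [_ ->|]; first by left.
case/andP => IK pK /(IH _ pK) {pK}.
have : mpoly_dot (chi R I) (chi R (NE n)) = mpoly_dot (chi R K) (chi R (NE n))
  \/ mpoly_dot (chi R I) (chi R (NE n)) = - mpoly_dot (chi R K) (chi R (NE n)).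
  case/orP: IK => [/(chi_flip R) -> | /existsP[s /eqP ->]].
    by right; rewrite mpoly_dotNl opprK.
  rewrite chi_perm -(mpoly_dot_msym s).
  by case: (msym_chi_NE R s) => ->; [left|right; rewrite mpoly_dotNr].
by move=> [] -> [] ->; rewrite ?opprK; [left|right|right|left].
Qed.

(** Exchanging two neighbouring indices affects only their order relative to each other, and that
    position is removed. *)
Lemma NE_setD1_perm n (k l : 'I_n) : val k = 0%N -> val l = 1%N ->
  perm_pattern (tperm k l) (NE n :\ (k, l)) = NE n :\ (k, l).
Proof.
move=> k0 l1; apply/setP => -[a b].
rewrite -{1}(tpermK k l a) -{1}(tpermK k l b) in_perm_pattern !inE !xpair_eqE.
rewrite -!val_eqE /=.
by case: tpermP => [->|->|/eqP + /eqP +]; case: tpermP => [->|->|/eqP + /eqP +];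
  rewrite -?val_eqE /= ?k0 ?l1; lia.
Qed.

Lemma mpoly_dot_target (R : realType) n (i k l : 'I_n) :
  val k = 0%N -> val l = 1%N -> (1 < i)%N ->
  mpoly_dot (chi R ((NE n :\ (k, l)) :|: [set (i, k)])) (chi R (NE n))
  = - (n`!%:R / 2%:R).
Proof.
move=> k0 l1 lti.
set J := chi R (NE n :\ (k, l)).
have symJ : msym (tperm k l) J = J by rewrite -chi_perm NE_setD1_perm.
have -> : chi R (NE n :\ (k, l) :|: [set (i, k)]) = ('X_i - 'X_k) * J.
  by rewrite /chi setUC big_setU1 //= !inE k0 andbF.
have NEJ : chi R (NE n) = ('X_k - 'X_l) * J.
  by rewrite /chi (big_setD1 (k, l)) //= inE /= k0 l1.
have symX a : msym (tperm k l) 'X_a = 'X_(tperm k l a) :> {mpoly R[n]}.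
  by rewrite /msym mmapX mmap1U.
have symNE : msym (tperm k l) (chi R (NE n)) = - chi R (NE n).
  by rewrite NEJ msymM msymB !symX tpermL tpermR symJ -mulNr opprB.
(* The isometry exchanging x_k and x_l turns x_i - x_k into x_i - x_l, fixes J and negates the right
   argument; the sign is moved to the left factor. *)
have E1 : mpoly_dot (('X_i - 'X_k) * J) (chi R (NE n))
    = mpoly_dot (('X_l - 'X_i) * J) (chi R (NE n)).
  rewrite -(mpoly_dot_msym (tperm k l)) symNE msymM msymB !symX symJ.
  rewrite tpermL tpermD -?val_eqE /= ?k0 ?l1; try by lia.
  by rewrite mpoly_dotNr -mpoly_dotNl -mulNr opprB.
have : mpoly_dot (('X_i - 'X_k) * J) (chi R (NE n))
    + mpoly_dot (('X_l - 'X_i) * J) (chi R (NE n)) = - n`!%:R.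
  rewrite -mpoly_dotDl -mulrDl addrC addrA subrK -mpoly_dot_chi_NE -mpoly_dotNl.
  by congr mpoly_dot; rewrite NEJ -mulNr opprB.
rewrite -E1; lra.
Qed.

(** * Singularity *)

(** The generators are symmetric, so the inverse permutation only has to be applied to the
    coefficients. *)
Lemma in_ideal_msym (R : realType) n (s : 'S_n) (p : {mpoly R[n]}) :
  in_ideal (fun k : 'I_n => mesym n R k.+1) (msym s p) ->
  in_ideal (fun k : 'I_n => mesym n R k.+1) p.
Proof.
case=> c E; exists (fun t => msym s^-1 (c t)).
apply: (inj_msym s); rewrite E raddf_sum; apply: eq_bigr => t _.
by rewrite /= msymM -msymMm mulVg msym1m (issymP _ (mesym_sym _ _ _)).
Qed.

Lemma singular_weakly_equivalent (R : realType) n (I J : pattern n) :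
  weakly_equivalent I J -> singular R J -> singular R I.
Proof.
case/connectP => p; elim: p I => [|K p IH] I /= => [_ -> //|].
case/andP => IK pK /(IH _ pK) H /H.
case/orP: IK => [/(chi_flip R) | /existsP[s /eqP ->]]; rewrite /singular.
  move=> E; rewrite -[chi R I]opprK -E -mulN1r.
  by apply: idealM; exact: in_ideal_is_ideal.
by rewrite chi_perm; apply: in_ideal_msym.
Qed.

Lemma ipow_nil (A : comNzRingType) (K : A -> Prop) d a :
  is_ideal K -> ipow K [::] d.+1 a -> K a.
Proof.
move=> Ki; move Ee: d.+1 => e H; elim: H d Ee => {e a} //.
by move=> e a b _ IHa _ IHb d Ee; apply: idealD => //;
  [apply: IHa Ee|apply: IHb Ee].
Qed.

Lemma sum1_ord_lt n m : (m <= n)%N -> (\sum_(a < n | (a < m)%N) 1 = m)%N.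
Proof.
by move=> le; rewrite -(big_ord_widen n (fun=> 1%N) le) sum1_card card_ord.
Qed.

Lemma singular_target (R : realType) n (i j k l : 'I_n) :
  val k = 0%N -> val l = 1%N -> (1 < j < i)%N ->
  singular R ((NE n :\ (k, l)) :|: [set (i, j)]).
Proof.
move=> k0 l1 /andP[ltj ltji].
pose K := in_ideal (fun k : 'I_n => mesym n R k.+1).
have Ki : is_ideal K by exact: in_ideal_is_ideal.
pose X (a : 'I_n) : {mpoly R[n]} := 'X_a.
(* As k and l have values 0 and 1, t holds x_k and x_l, and u the other variables. *)
pose t := [seq X a | a : 'I_n <- enum 'I_n & (a < 2)%N].
pose u := [seq X a | a : 'I_n <- enum 'I_n & ~~ (a < 2)%N].
have le2n : (2 <= n)%N by have := ltn_ord i; lia.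
have szt : size t = 2.
  rewrite size_map size_filter -sum1_count big_enum_cond /=.
  exact: sum1_ord_lt.
have szut : size (u ++ t) = n.
  by rewrite -map_cat size_map size_cat !size_filter addnC count_predC
    size_enum_ord.
have Hut : sym_tail K [::] (u ++ t).
  move=> d; have := @sym_tail_mesym R n d.
  rewrite size_map size_enum_ord szut.
  suff -> : root_poly (u ++ t) = root_poly [seq X a | a <- enum 'I_n] by [].
  rewrite /root_poly; apply: perm_big; rewrite -map_cat; apply: perm_map.
  by rewrite perm_catC perm_filterC.
(* The starting exponent is 1, since (s)^1 + K is K for empty s; as ['C(2, 2)] is 1, the final
   exponent is ['C(n, 2)]. *)
have [||Ht HK] := @ipow_catrev_sub_ideal _ K u [::] t 1 'C(n, 2) Ki Hut.
- by move=> z; apply: ipow_nil.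
- by rewrite szut szt binn addnC.
have Xu (a : 'I_n) : (1 < a)%N -> X a \in catrev u [::].
  move=> lta; rewrite catrevE cats0 mem_rev; apply: map_f.
  by rewrite mem_filter -leqNgt lta mem_enum.
have X1 (a b : 'I_n) : (1 < a)%N -> (1 < b)%N ->
    ipow K (catrev u [::]) 1 (X a - X b).
  move=> lta ltb; apply: IPowD; first exact/ipow_mem/Xu.
  by rewrite -mulN1r; apply: ipowMl => //; exact/ipow_mem/Xu.
(* Column b has b factors. The two with a < 2 form, up to sign, [root_poly t] at x_b, of order 2;
   the other b - 2 have order 1 each. *)
have col (b : 'I_n) : (1 < b)%N ->
    ipow K (catrev u [::]) b (\prod_(a < n | (a < b)%N) (X a - X b)).
  move=> ltb; rewrite (bigID (fun a : 'I_n => (a < 2)%N)) /=.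
  have eq2 (a : 'I_n) : ((a < b) && (a < 2))%N = (a < 2)%N by lia.
  have bE : nat_of_ord b = (2 + \sum_(a < n | (a < b)%N && ~~ (a < 2)%N) 1)%N.
    rewrite -[LHS](sum1_ord_lt (ltnW (ltn_ord b))).
    rewrite (bigID (fun a : 'I_n => (a < 2)%N)) /=.
    by rewrite (eq_bigl _ _ eq2) sum1_ord_lt.
  rewrite [X in ipow _ _ X _]bE; apply: ipowM => //; last first.
    by apply: ipow_prod => // a /andP[_ lta]; apply: X1; rewrite // ltnNge.
  rewrite (eq_bigl _ _ eq2); under eq_bigr do rewrite -opprB.
  rewrite prodrN; apply: ipowMl => //.
  have := sym_tail_horner Ki Ht (Xu b ltb); rewrite szt.
  rewrite /root_poly big_map big_filter big_enum_cond horner_prod /=.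
  by under eq_bigr do rewrite hornerXsubC.
apply: HK.
(* Column 1 contained only the removed position (k, l), so the columns with b > 1 remain. *)
have -> : chi R ((NE n :\ (k, l)) :|: [set (i, j)])
    = (X i - X j) *
      \prod_(b < n | (1 < b)%N) \prod_(a < n | (a < b)%N) (X a - X b).
  rewrite /chi setUC big_setU1 /=; last first.
    by rewrite !inE negb_and -leqNgt (ltnW ltji) orbT.
  congr (_ * _); rewrite (exchange_big_dep xpredT) //= pair_big_dep /=.
  apply: eq_bigl => -[a b]; rewrite !inE xpair_eqE -!val_eqE /= k0 l1; lia.
(* Of the sum of all b < n, the terms b = 0 and b = 1 contribute 1 in total; this missing order is
   supplied by the factor x_i - x_j. *)
have -> : 'C(n, 2) = (1 + \sum_(b < n | (1 < b)%N) b)%N.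
  rewrite -bin2_sum big_mkord (bigID (fun b : 'I_n => (1 < b)%N)) /= addnC.
  congr (_ + _)%N; rewrite (bigD1 l) ?l1 //= big1 ?addn0 //.
  by move=> b; rewrite -val_eqE /= l1; lia.
apply: ipowM => //; first by apply: X1; lia.
by apply: ipow_prod.
Qed.

(** * Reduction to the two normal forms *)

Lemma pos1E n (i j : 'I_n) : pos1 n i.+1 j.+1 = [set (i, j)].
Proof. by apply/setP => -[a b]; rewrite !inE xpair_eqE. Qed.

Lemma size_uniq_ord n (s : seq 'I_n) : uniq s -> (size s <= n)%N.
Proof.
by move=> /card_uniqP <-; rewrite -[X in (_ <= X)%N]card_ord max_card.
Qed.

Lemma shape_shared (R : realType) n (I : pattern n) c d m :
  uniq [:: d; c; m] -> shape I d c c m ->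
  [/\ (3 <= n)%N,
      weakly_equivalent I ((NE n :\: pos1 n 1 2) :|: pos1 n 3 1)
    & mpoly_dot (chi R I) (chi R (NE n)) = n`!%:R / 2%:R \/
      mpoly_dot (chi R I) (chi R (NE n)) = - (n`!%:R / 2%:R)].
Proof.
move=> u H; have len := size_uniq_ord u; rewrite /= in len.
pose p0 := Ordinal (ltnW (ltnW len)); pose p1 := Ordinal (ltnW len).
pose p2 := Ordinal len.
(* The normal form lacks {1, 2} and doubles {1, 3}, so the shared index c goes to 1. *)
have [s [sd sc sm]] : exists s : 'S_n, map s [:: d; c; m] = [:: p2; p0; p1].
  exact: exists_perm_map.
have W : weakly_equivalent I ((NE n :\: pos1 n 1 2) :|: pos1 n 3 1).
  apply: (@shape_weakly_equivalent _ _ _ _ _ _ _ s H); rewrite sd sc sm.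
  exact: shape_target.
split=> //; have := mpoly_dot_weakly_equivalent R W.
rewrite (pos1E p0 p1) (pos1E p2 p0) mpoly_dot_target // opprK.
by case; [right|left].
Qed.

Lemma shape_disjoint (R : realType) n (I : pattern n) i j k l :
  uniq [:: i; j; k; l] -> shape I i j k l ->
  [/\ singular R I, (4 <= n)%N
    & weakly_equivalent I ((NE n :\: pos1 n 1 2) :|: pos1 n 4 3)].
Proof.
move=> u H; have len := size_uniq_ord u; rewrite /= in len.
pose p0 := Ordinal (ltnW (ltnW (ltnW len))).
pose p1 := Ordinal (ltnW (ltnW len)).
pose p2 := Ordinal (ltnW len); pose p3 := Ordinal len.
have [s [si sj sk sl]] :
    exists s : 'S_n, map s [:: i; j; k; l] = [:: p3; p2; p0; p1].
  exact: exists_perm_map.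
have W : weakly_equivalent I ((NE n :\: pos1 n 1 2) :|: pos1 n 4 3).
  apply: (@shape_weakly_equivalent _ _ _ _ _ _ _ s H); rewrite si sj sk sl.
  exact: shape_target.
split=> //; apply: singular_weakly_equivalent W _.
rewrite (pos1E p0 p1) (pos1E p3 p2); exact: singular_target.
Qed.

Theorem theorem4p2 (R : realType) (n : nat) (I : {set 'I_n * 'I_n})
    (I_strict : strict I)
    (I_size : #|I| = (n * (n - 1) %/ 2)%N)
    (I_complexity : complexity I = 1%N) :
  (exists! A : {set 'I_n}, double_pair I A) /\
  (exists! B : {set 'I_n}, missing_pair I B) /\
  forall i j k l : 'I_n,
    double_pair I [set i; j] -> missing_pair I [set k; l] ->
    (* (a) *)
    (~~ uniq [:: i; j; k; l] ->
      [/\ (3 <= n)%N,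
          weakly_equivalent I ((NE n :\: pos1 n 1 2) :|: pos1 n 3 1)
        & mpoly_dot (chi R I) (chi R (NE n)) = n`!%:R / 2%:R \/
          mpoly_dot (chi R I) (chi R (NE n)) = - (n`!%:R / 2%:R)]) /\
    (* (b) *)
    (uniq [:: i; j; k; l] ->
      [/\ singular R I, (4 <= n)%N
        & weakly_equivalent I ((NE n :\: pos1 n 1 2) :|: pos1 n 4 3)]).
Proof.
rewrite -bin2_half in I_size.
split; first exact: unique_double_pair.
split; first exact: unique_missing_pair.
have shared c d m : double_pair I [set d; c] -> missing_pair I [set c; m] ->
    [/\ (3 <= n)%N,
        weakly_equivalent I ((NE n :\: pos1 n 1 2) :|: pos1 n 3 1)
      & mpoly_dot (chi R I) (chi R (NE n)) = n`!%:R / 2%:R \/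
        mpoly_dot (chi R I) (chi R (NE n)) = - (n`!%:R / 2%:R)].
  move=> D M; apply: (@shape_shared _ _ _ c d m); last exact: shapeP.
  have := D; have := M; rewrite double_pair2 missing_pair2.
  move=> /andP[ncm /eqP cm0] /andP[ndc /eqP dc2].
  rewrite /= !inE negb_or ndc ncm !andbT /=.
  by apply/eqP => dm; move: cm0; rewrite -dm multC dc2.
move=> i j k l D M; split=> [nu|u]; last first.
  by apply: shape_disjoint u _; exact: shapeP.
have := D; have := M; rewrite double_pair2 missing_pair2.
move=> /andP[nkl _] /andP[nij _].
move: nu; rewrite /= !inE !negb_or nij nkl /= !andbT.
(* Each of the four coincidences is reordered so that the shared index is second in the doubled pair
   and first in the missing one. *)
have [Eik _|_] := eqVneq i k.
  by apply: (shared k j l); rewrite // setUC -Eik.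
have [Eil _|_] := eqVneq i l.
  by apply: (shared l j k); rewrite setUC // -Eil.
have [Ejk _|_] := eqVneq j k.
  by apply: (shared k i l); rewrite // -Ejk.
have [Ejl _|//] := eqVneq j l.
by apply: (shared l i k); [rewrite -Ejl|rewrite setUC].
Qed.
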